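(* Let $X$ be a random variable, let $\phi:\mathbb{R}\to\mathbb{R}$ be a function, and let $p\in[0,1]$. (a) Suppose $\phi$ is non-increasing and right continuous on $\mathbb{R}$. Then $$lq_{\phi(X)}(p)=\phi\bigl(rq_X(1-p)\bigr).$$ (b) Suppose $\phi$ is non-increasing and left continuous on $\mathbb{R}$. Then $$rq_{\phi(X)}(p)=\phi\bigl(lq_X(1-p)\bigr).$$
   Context: For a real-valued random variable $Y$ with distribution function $F_Y(x)=P(Y\le x)$, $x\in\mathbb{R}$, the left quantile function is $lq_Y(p)=\inf\{x : F_Y(x)\ge p\}$ and the right quantile function is $rq_Y(p)=\inf\{x : F_Y(x)>p\}=\sup\{x : F_Y(x)\le p\}$.
   Formalization: φ at ±∞ means its limit there; since lq(0) = −∞ and rq(1) = +∞ always, the formulas fail for constant φ at p = 0 in (a) and p = 1 in (b), so there it is also assumed that φ → −∞ at +∞, respectively φ → +∞ at −∞. *)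

(* Defs.v *)
From HB Require Import structures.
From mathcomp Require Export all_boot all_order all_algebra.
From mathcomp Require Export all_classical all_reals all_analysis.
From mathcomp Require Export measurable_realfun.

Set Implicit Arguments.
Unset Strict Implicit.
Unset Printing Implicit Defensive.

Export Order.TTheory GRing.Theory Num.Theory.
Export numFieldNormedType.Exports.

Local Open Scope classical_set_scope.
Local Open Scope ring_scope.

Section Quantiles.
Context d (T : measurableType d) (R : realType) (P : probability T R).

(* The quantiles are taken in the extended reals: [lq Y 0 = -oo] and
   [rq Y 1 = +oo] for every [Y], while [lq Y 1] and [rq Y 0] are infinite when
   [Y] is unbounded above, respectively below. *)
Definition lq (Y : {RV P >-> R}) (p : R) : \bar R :=
  ereal_inf (EFin @` [set x : R | (p%:E <= cdf Y x)%E]).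

Definition rq (Y : {RV P >-> R}) (p : R) : \bar R :=
  ereal_inf (EFin @` [set x : R | (p%:E < cdf Y x)%E]).

(* Monotonicity of [phi] is what makes [phi \o X] measurable. *)
Definition noninc_comp (phi : R -> R) (phi_ni : nonincreasing_fun phi)
    (X : {RV P >-> R}) : {RV P >-> R} :=
  mfun_Sub (mem_set (measurableT_comp
    (nonincreasing_measurable measurableT phi_ni) (measurable_funPT X))).

Lemma noninc_compE (phi : R -> R) (phi_ni : nonincreasing_fun phi)
    (X : {RV P >-> R}) : noninc_comp phi_ni X = phi \o X :> (T -> R).
Proof. by []. Qed.

End Quantiles.

(* Value of [phi] at an extended real: itself on the reals, its limit in
   [\bar R] at the infinities (the limits exist when [phi] is monotone). *)
Definition ext_val (R : realType) (phi : R -> R) (x : \bar R) : \bar R :=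
  match x with
  | r%:E => (phi r)%:E
  | +oo%E => lim ((phi t)%:E @[t --> +oo])
  | -oo%E => lim ((phi t)%:E @[t --> -oo])
  end.

Notation left_continuous f :=
  (forall x, f%function @ at_left x --> f%function x).

(* Main.v *)
Require Import Defs.
From mathcomp Require Import lra.

Set Implicit Arguments.
Unset Strict Implicit.
Unset Printing Implicit Defensive.

(** A nonincreasing map turns lower tails into upper tails: [phi (X t) <= y]
    contains the upper tail [X t >= e] as soon as [phi e <= y], and is contained
    in the upper tail [X t > e] as soon as [y < phi e].  The proof works with
    thresholds [e] in the extended reals, [phi] being extended by its limits, so
    that finite and infinite quantiles follow the same argument.

    To identify a quantile of [Y = phi (X)], an infimum, with [phi e], it is
    enough to show that the level condition on [cdf Y y] implies [phi e <= y]
    and is implied by [phi e < y] ([ereal_inf_EFin_eq]).  Each of the two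
    quantiles [e] of [X] at level [1 - p] gives one of the implications by
    what it says about its own tail:
    - for [rq], [P (X >= rq) >= p] ([distribution_ge_rq]), hence
      [cdf Y y >= p] when [phi rq <= y];
    - for [lq], [P (X > lq) <= p] ([distribution_gt_lq]), hence
      [cdf Y y <= p] when [y < phi lq].
    The other implication is where the one-sided continuity of [phi] enters.
    If [y < phi rq], right continuity gives [c > rq] with [y < phi c], and there
    [P (X > c) < p]; if [phi lq < y], left continuity gives [c < lq] with
    [phi c < y], and there [P (X > c) > p].  So the side on which [phi] is
    continuous is the side on which the quantile gives strict inequalities.

    A strict inequality needs a point beyond the quantile, which is missing for
    [rq = +oo] and [lq = -oo].  These values force [p = 0] and [p = 1]
    respectively, and the assumed infinite limits of [phi] leave no [y] to
    consider. *)

Local Open Scope classical_set_scope.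
Local Open Scope ring_scope.

(** * Nonincreasing functions on the extended line *)

Section ExtVal.
Context (R : realType) (phi : R -> R) (phi_ni : nonincreasing_fun phi).

Lemma ext_val_pinfty : ext_val phi +oo = ereal_inf (range (EFin \o phi)).
Proof.
apply: cvg_lim => //; apply: nonincreasing_cvge => x y xy /=.
by rewrite lee_fin phi_ni.
Qed.

Lemma ext_val_ninfty : ext_val phi -oo = ereal_sup (range (EFin \o phi)).
Proof.
apply: cvg_lim => //; apply/cvgNy_compNP.
have -> : range (EFin \o phi) = range ((EFin \o phi) \o -%R).
  apply/seteqP; split=> _ [x _ <-]; last by exists (- x).
  by exists (- x) => //=; rewrite opprK.
apply: nondecreasing_cvge => x y xy /=.
by rewrite lee_fin phi_ni// lerN2.
Qed.

Lemma ext_val_le (e : \bar R) (x : R) :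
  (e <= x%:E)%E -> ((phi x)%:E <= ext_val phi e)%E.
Proof.
case: e => [r| |] ex //; last first.
  by rewrite ext_val_ninfty; apply: ereal_sup_ubound; exists x.
by rewrite lee_fin phi_ni -?lee_fin.
Qed.

Lemma ext_val_ge (e : \bar R) (x : R) :
  (x%:E <= e)%E -> (ext_val phi e <= (phi x)%:E)%E.
Proof.
case: e => [r| |] ex //; last first.
  by rewrite ext_val_pinfty; apply: ereal_inf_lbound; exists x.
by rewrite lee_fin phi_ni -?lee_fin.
Qed.

(** Right continuity at a real [e]; at [-oo] it holds by the definition of
    [ext_val] as a supremum there.  At [+oo] there is no point to the right. *)
Lemma ext_val_gt_right (e : \bar R) (y : R) : right_continuous phi ->
  e != +oo%E -> (y%:E < ext_val phi e)%E ->
  exists2 c : R, (e < c%:E)%E & y < phi c.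
Proof.
move=> phi_rc; case: e => [r _| |_] //.
- rewrite lte_fin => yr.
  have yphi : \forall t \near r^'+, y < phi t by exact: cvgr_gt (phi_rc r) _ yr.
  have [c [rc yc]] := filter_ex (filterI (nbhs_right_gt r) yphi).
  by exists c; rewrite ?lte_fin.
- rewrite ext_val_ninfty => /ereal_sup_gtP[_ [c _ <-] yc].
  by exists c; rewrite -?lte_fin// ltNyr.
Qed.

(** The mirror image of [ext_val_gt_right]: here [+oo] is harmless, the value
    there being an infimum. *)
Lemma ext_val_lt_left (e : \bar R) (y : R) : left_continuous phi ->
  e != -oo%E -> (ext_val phi e < y%:E)%E ->
  exists2 c : R, (c%:E < e)%E & phi c < y.
Proof.
move=> phi_lc; case: e => [r _|_|] //.
- rewrite lte_fin => yr.
  have yphi : \forall t \near r^'-, phi t < y by exact: cvgr_lt (phi_lc r) _ yr.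
  have [c [rc yc]] := filter_ex (filterI (nbhs_left_lt r) yphi).
  by exists c; rewrite ?lte_fin.
- rewrite ext_val_pinfty => /ereal_inf_ltP[_ [c _ <-] yc].
  by exists c; rewrite -?lte_fin// ltry.
Qed.

End ExtVal.

(** * Tail probabilities at quantiles *)

Section Tails.
Context d (T : measurableType d) (R : realType) (P : probability T R).
Implicit Types (X : {RV P >-> R}) (e : \bar R) (p q x : R).

Lemma measurable_gt_ereal e : measurable [set x : R | (e < x%:E)%E].
Proof.
case: e => [r| |].
- rewrite (_ : mkset _ = `]r, +oo[%classic)//.
  by apply/seteqP; split=> x /=; rewrite in_itv/= andbT lte_fin.
- by rewrite (_ : mkset _ = set0)//; apply/seteqP; split.
- rewrite (_ : mkset _ = setT)//; apply/seteqP; split=> // x _.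
  exact: ltNyr.
Qed.

Lemma measurable_ge_ereal e : measurable [set x : R | (e <= x%:E)%E].
Proof.
case: e => [r| |].
- rewrite (_ : mkset _ = `[r, +oo[%classic)//.
  by apply/seteqP; split=> x /=; rewrite in_itv/= andbT lee_fin.
- by rewrite (_ : mkset _ = set0)//; apply/seteqP; split.
- rewrite (_ : mkset _ = setT)//; apply/seteqP; split=> // x _.
  exact: leNye.
Qed.

Lemma cdf_lt_of_lt_lq X q x : (x%:E < lq X q)%E -> (cdf X x < q%:E)%E.
Proof.
rewrite [in X in X -> _]ltNge [in X in _ -> X]ltNge.
by apply: contra => qx; apply: ereal_inf_lbound; exists x.
Qed.

Lemma le_cdf_of_lq_lt X q x : (lq X q < x%:E)%E -> (q%:E <= cdf X x)%E.
Proof.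
move=> /ereal_inf_ltP[_ [z qz <-]]; rewrite lte_fin => zx.
exact: le_trans qz (cdf_nondecreasing X (ltW zx)).
Qed.

Lemma cdf_le_of_lt_rq X q x : (x%:E < rq X q)%E -> (cdf X x <= q%:E)%E.
Proof.
rewrite [in X in X -> _]ltNge [in X in _ -> X]leNgt.
by apply: contra => qx; apply: ereal_inf_lbound; exists x.
Qed.

Lemma lt_cdf_of_rq_lt X q x : (rq X q < x%:E)%E -> (q%:E < cdf X x)%E.
Proof.
move=> /ereal_inf_ltP[_ [z qz <-]]; rewrite lte_fin => zx.
exact: lt_le_trans qz (cdf_nondecreasing X (ltW zx)).
Qed.

(** Every real lies above the quantile, so the cdf is at least [q] everywhere,
    while it tends to 0 at [-oo]. *)
Lemma lq_eqNy_le0 X q : lq X q = -oo%E -> q <= 0.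
Proof.
move=> lqNy; rewrite -lee_fin.
apply: cvge_to_ge (@cvg_cdfNy0 _ _ _ _ X) _.
by apply: nearW => x; apply: le_cdf_of_lq_lt; rewrite lqNy ltNyr.
Qed.

(** Every real lies below the quantile, so the cdf is at most [q] everywhere,
    while it tends to 1 at [+oo]. *)
Lemma rq_eqy_ge1 X q : rq X q = +oo%E -> 1 <= q.
Proof.
move=> rqy; rewrite -lee_fin.
apply: cvge_to_le (@cvg_cdfy1 _ _ _ _ X) _.
by apply: nearW => x; apply: cdf_le_of_lt_rq; rewrite rqy ltry.
Qed.

(** The infimum defining [lq] is attained, by right continuity of the cdf. *)
Lemma le_cdf_lq X q r : lq X q = r%:E -> (q%:E <= cdf X r)%E.
Proof.
move=> lqr; apply: cvge_to_ge (@cdf_right_continuous _ _ _ _ X r) _.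
apply: filterS (nbhs_right_gt r) => x rx.
by apply: le_cdf_of_lq_lt; rewrite lqr lte_fin.
Qed.

(** [P (X < r)] is the left limit of the cdf, by continuity of [P] along the
    events [X <= r - 1/(n+1)]. *)
Lemma distribution_lt_rq X q r : rq X q = r%:E ->
  (distribution P X `]-oo, r[ <= q%:E)%E.
Proof.
move=> rqr; pose F n := `]-oo, r - n.+1%:R^-1]%classic : set R.
have FE : `]-oo, r[%classic = \bigcup_n F n.
  apply/seteqP; split=> [x|x [n _]]; rewrite /F /= !in_itv /=; last first.
    by move=> /le_lt_trans; apply; rewrite gtrBl invr_gt0.
  (* [n + 1] has to exceed [1 / (r - x)], so that [x <= r - 1 / (n + 1)]. *)
  move=> xr; exists (Num.truncn (r - x)^-1) => //=; rewrite in_itv/=.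
  rewrite lerBrDl -lerBrDr -[leRHS]invrK lef_pV2 ?posrE ?invr_gt0 ?subr_gt0//.
  by rewrite ltW// truncnS_gt.
have Fcvg : distribution P X (F n) @[n --> \oo] --> distribution P X `]-oo, r[.
  rewrite FE; apply: nondecreasing_cvg_mu => [n||m n mn].
  - exact: measurable_itv.
  - by apply: bigcup_measurable => n _; exact: measurable_itv.
  - apply/subsetPset; apply: subset_itvl.
    by rewrite bnd_simp lerB// lef_pV2 ?posrE// ler_nat.
apply: cvge_to_le Fcvg _; apply: nearW => n; apply: cdf_le_of_lt_rq.
by rewrite rqr lte_fin gtrBl invr_gt0.
Qed.

(** At a finite quantile this is the complement of [le_cdf_lq].  A quantile
    [+oo] makes the event empty, and [-oo] forces [p = 1]. *)
Lemma distribution_gt_lq X p : 0 <= p <= 1 ->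
  (distribution P X [set x | (lq X (1 - p) < x%:E)%E] <= p%:E)%E.
Proof.
move=> /andP[p0 p1].
case E : (lq X (1 - p)) => [r| |].
- rewrite (_ : [set x | _] = `]r, +oo[%classic); last first.
    by apply/seteqP; split=> x /=; rewrite in_itv/= andbT lte_fin.
  rewrite -/(ccdf X r) ccdf_1_cdf; have := le_cdf_lq E.
  have : cdf X r \is a fin_num by exact: fin_num_measure.
  by case: (cdf X r) => // f _; rewrite -EFinB !lee_fin; lra.
- rewrite (_ : [set x | _] = set0) ?measure0 ?lee_fin//.
  by apply/seteqP; split.
- have -> : p = 1 by have := lq_eqNy_le0 E; lra.
  exact: probability_le1 (measurable_gt_ereal _).
Qed.

(** At a finite quantile this is the complement of [distribution_lt_rq].  A
    quantile [-oo] makes the event certain, and [+oo] forces [p = 0]. *)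
Lemma distribution_ge_rq X p : 0 <= p <= 1 ->
  (p%:E <= distribution P X [set x | (rq X (1 - p) <= x%:E)%E])%E.
Proof.
move=> /andP[p0 p1].
case E : (rq X (1 - p)) => [r| |].
- rewrite (_ : [set x | _] = ~` `]-oo, r[%classic); last first.
    by rewrite setCitvl; apply/seteqP; split=> x /=; rewrite in_itv/= andbT lee_fin.
  have -> : distribution P X (~` `]-oo, r[) = (1 - distribution P X `]-oo, r[)%E.
    exact: probability_setC.
  have := distribution_lt_rq E.
  have : distribution P X `]-oo, r[ \is a fin_num by exact: fin_num_measure.
  by case: (distribution P X `]-oo, r[) => // f _; rewrite -EFinB !lee_fin; lra.
- have -> : p = 0 by have := rq_eqy_ge1 E; lra.
  exact: measure_ge0.
- rewrite (_ : [set x | _] = setT) ?probability_setT ?lee_fin//.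
  by apply/seteqP; split=> // x _; exact: leNye.
Qed.

Lemma lt_ccdf_of_lt_lq X p x : (x%:E < lq X (1 - p))%E -> (p%:E < ccdf X x)%E.
Proof.
move=> /cdf_lt_of_lt_lq; rewrite ccdf_1_cdf.
have : cdf X x \is a fin_num by exact: fin_num_measure.
by case: (cdf X x) => // f _; rewrite -EFinB !lte_fin; lra.
Qed.

Lemma ccdf_lt_of_rq_lt X p x : (rq X (1 - p) < x%:E)%E -> (ccdf X x < p%:E)%E.
Proof.
move=> /lt_cdf_of_rq_lt; rewrite ccdf_1_cdf.
have : cdf X x \is a fin_num by exact: fin_num_measure.
by case: (cdf X x) => // f _; rewrite -EFinB !lte_fin; lra.
Qed.

End Tails.

(** * Transport of tails by a nonincreasing function *)

Section Transport.
Context d (T : measurableType d) (R : realType) (P : probability T R).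
Context (X : {RV P >-> R}) (phi : R -> R) (phi_ni : nonincreasing_fun phi).
Let Y := noninc_comp phi_ni X.

Lemma cdf_noninc_comp y :
  cdf Y y = distribution P X [set x | phi x <= y].
Proof.
by rewrite /cdf /distribution /pushforward; congr (P _).
Qed.

Lemma measurable_noninc_le y : measurable [set x | phi x <= y].
Proof.
rewrite (_ : mkset _ = phi @^-1` `]-oo, y]); last first.
  by apply/seteqP; split=> x /=; rewrite in_itv.
by rewrite -[_ @^-1` _]setTI; exact: nonincreasing_measurable.
Qed.

Lemma distribution_ge_le_cdf e y : (ext_val phi e <= y%:E)%E ->
  (distribution P X [set x | (e <= x%:E)%E] <= cdf Y y)%E.
Proof.
move=> ey; rewrite cdf_noninc_comp le_measure ?inE//.
- exact: measurable_ge_ereal.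
- exact: measurable_noninc_le.
- by move=> x /= /(ext_val_le phi_ni)/le_trans/(_ ey); rewrite lee_fin.
Qed.

Lemma cdf_le_distribution_gt e y : (y%:E < ext_val phi e)%E ->
  (cdf Y y <= distribution P X [set x | (e < x%:E)%E])%E.
Proof.
move=> ey; rewrite cdf_noninc_comp le_measure ?inE//.
- exact: measurable_noninc_le.
- exact: measurable_gt_ereal.
- move=> x /= xy; rewrite ltNge; apply/negP => /(ext_val_ge phi_ni).
  by move=> /(lt_le_trans ey); rewrite lte_fin ltNge xy.
Qed.

Lemma ccdf_le_cdf c y : phi c <= y -> (ccdf X c <= cdf Y y)%E.
Proof.
move=> cy; rewrite cdf_noninc_comp le_measure ?inE//.
- exact: measurable_noninc_le.
- move=> x /=; rewrite in_itv/= andbT => /ltW cx.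
  exact: le_trans (phi_ni cx) cy.
Qed.

Lemma cdf_le_ccdf c y : y < phi c -> (cdf Y y <= ccdf X c)%E.
Proof.
move=> cy; rewrite cdf_noninc_comp le_measure ?inE//.
- exact: measurable_noninc_le.
- move=> x /= xy; rewrite in_itv/= andbT ltNge; apply/negP => /phi_ni.
  by move=> /(lt_le_trans cy); rewrite ltNge xy.
Qed.

End Transport.

(** * Quantiles of a nonincreasing image *)

(** The set of admissible [y] is only pinned down up to the end point [e]: this
    freedom is what lets left and right quantiles be treated alike. *)
Lemma ereal_inf_EFin_eq (R : realType) (S : set R) (e : \bar R) :
  (forall y, S y -> (e <= y%:E)%E) -> (forall y : R, (e < y%:E)%E -> S y) ->
  ereal_inf (EFin @` S) = e.
Proof.
move=> eS Se; apply/eqP; rewrite eq_le; apply/andP; split; last first.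
  by apply/ereal_infP => _ [y Sy <-]; exact: eS.
have le_gt (y : R) : (e < y%:E)%E -> (ereal_inf (EFin @` S) <= y%:E)%E.
  by move=> /Se Sy; apply: ereal_inf_lbound; exists y.
case: e {eS Se} le_gt => [r| |] le_gt; rewrite ?leey//.
  by apply/lee_addgt0Pr => u u0; rewrite -EFinD le_gt// lte_fin ltrDl.
by rewrite leeNy_eq; apply/eqP/eq_ninfty => A; rewrite le_gt// ltNyr.
Qed.

Theorem theorem4p1 (d : measure_display) (T : measurableType d) (R : realType)
    (P : probability T R) (X : {RV P >-> R}) (phi : R -> R)
    (phi_ni : nonincreasing_fun phi) (p : R) (p01 : 0 <= p <= 1) :
  (right_continuous phi ->
   (p = 0 -> phi t @[t --> +oo] --> -oo) ->
   lq (noninc_comp phi_ni X) p = ext_val phi (rq X (1 - p)))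
  /\
  (left_continuous phi ->
   (p = 1 -> phi t @[t --> -oo] --> +oo) ->
   rq (noninc_comp phi_ni X) p = ext_val phi (lq X (1 - p))).
Proof.
have /andP[p0 p1] := p01.
split=> [phi_rc phiNy|phi_lc phiy]; apply: ereal_inf_EFin_eq => y.
- move=> py; rewrite leNgt; apply/negP => yrq.
  (* At [rq X (1 - p) = +oo], [ext_val phi] is [-oo], which is not above [y]. *)
  have rqfin : rq X (1 - p) != +oo%E.
    apply/eqP => rqy; have p_eq0 : p = 0 by have := rq_eqy_ge1 rqy; lra.
    have E : ext_val phi +oo%E = -oo%E.
      by apply: cvg_lim => //; apply/cvgerNyP/phiNy.
    by rewrite rqy E in yrq.
  have [c rqc yc] := ext_val_gt_right phi_ni phi_rc rqfin yrq.
  have := le_lt_trans (cdf_le_ccdf X phi_ni yc) (ccdf_lt_of_rq_lt rqc).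
  by rewrite ltNge py.
- move=> /ltW rqy.
  exact: le_trans (distribution_ge_rq X p01) (distribution_ge_le_cdf X phi_ni rqy).
- move=> py; rewrite leNgt; apply/negP => ylq.
  have := le_trans (cdf_le_distribution_gt X phi_ni ylq) (distribution_gt_lq X p01).
  by rewrite leNgt py.
- move=> lqy.
  (* At [lq X (1 - p) = -oo], [ext_val phi] is [+oo], which is not below [y]. *)
  have lqfin : lq X (1 - p) != -oo%E.
    apply/eqP => lqNy; have p_eq1 : p = 1 by have := lq_eqNy_le0 lqNy; lra.
    have E : ext_val phi -oo%E = +oo%E.
      by apply: cvg_lim => //; apply/cvgeryP/phiy.
    by rewrite lqNy E in lqy.
  have [c clq cy] := ext_val_lt_left phi_ni phi_lc lqfin lqy.
  exact: lt_le_trans (lt_ccdf_of_lt_lq clq) (ccdf_le_cdf X phi_ni (ltW cy)).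
Qed.
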